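(* $BR(C_{10},C_8)=8$.
   Context: $C_m$ denotes the cycle on $m$ vertices and $K_{b,b}$ the complete bipartite graph with both parts of size $b$. For bipartite graphs $G_1,G_2$, $BR(G_1,G_2)$ is the smallest positive integer $b$ such that for every 2-edge-coloring of $K_{b,b}$ with colors 1 and 2, there is a subgraph isomorphic to $G_1$ all of whose edges have color 1, or a subgraph isomorphic to $G_2$ all of whose edges have color 2. *)

(* Defs.v *)
From HB Require Import structures.
From mathcomp Require Import all_boot.

Set Implicit Arguments.
Unset Strict Implicit.
Unset Printing Implicit Defensive.

Record sgraph := SGraph {
  vertex :> finType;
  adj : rel vertex;
  adj_sym : symmetric adj;
  adj_irrefl : irreflexive adj }.

Section CycleGraph.
Variable m : nat.

(* The conjunct [i != j] only matters for m = 1; for m >= 3 this is C_m. *)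
Definition cycle_adj : rel 'I_m :=
  fun i j => (i != j) && ((i.+1 == j %[mod m]) || (j.+1 == i %[mod m])).

Fact cycle_adj_sym : symmetric cycle_adj.
Proof. by move=> i j; rewrite /cycle_adj eq_sym orbC. Qed.

Fact cycle_adj_irrefl : irreflexive cycle_adj.
Proof. by move=> i; rewrite /cycle_adj eqxx. Qed.

Definition cycle_graph : sgraph := SGraph cycle_adj_sym cycle_adj_irrefl.

End CycleGraph.

Section CompleteBipartite.
Variables a b : nat.

Definition bipartite_adj : rel ('I_a + 'I_b)%type :=
  fun u v => match u, v with
             | inl _, inr _ | inr _, inl _ => true
             | _, _ => false
             end.

Fact bipartite_adj_sym : symmetric bipartite_adj.
Proof. by case=> i [] j. Qed.

Fact bipartite_adj_irrefl : irreflexive bipartite_adj.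
Proof. by case. Qed.

Definition complete_bipartite : sgraph :=
  SGraph bipartite_adj_sym bipartite_adj_irrefl.

End CompleteBipartite.

(* An edge is the unordered pair [set u; v] of its ends. A colouring is a
   total function on sets of vertices, of which only the values at edges are
   ever used. Colour 1 is [true] and colour 2 is [false]. *)
Definition edge_coloring (H : sgraph) := {set H} -> bool.

(* [f] embeds [G] as a not necessarily induced subgraph of [H]. *)
Definition has_mono_copy (G H : sgraph) (c : edge_coloring H) (k : bool) :=
  exists f : G -> H, injective f /\
    forall x y : G, adj x y -> adj (f x) (f y) /\ c [set f x; f y] = k.

Definition bipartite_arrows (b : nat) (G1 G2 : sgraph) :=
  forall c : edge_coloring (complete_bipartite b b),
    has_mono_copy G1 c true \/ has_mono_copy G2 c false.

(* [is_BR G1 G2 b] states BR(G1, G2) = b. *)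
Definition is_BR (G1 G2 : sgraph) (b : nat) :=
  [/\ 0 < b, bipartite_arrows b G1 G2 &
      forall b', 0 < b' -> bipartite_arrows b' G1 G2 -> b <= b'].

(* Main.v *)
(** Red is colour 1 and blue colour 2.  For the lower bound, colour the edges
    at four vertices of one side red and all other edges blue: a [C10] needs
    five vertices of that side, and fewer than four remain for a blue [C8].

    For the upper bound, suppose that a colouring of [K_{8,8}] has neither a
    red [C10] nor a blue [C8].  One shows in turn that it has no red [C8], no
    red [C6], no red [C4], and that without red [C4] it has a blue [C8].
    Each step is a case analysis on the colours of single edges, in which an
    edge is forced as soon as the opposite colour completes a pattern already
    excluded.  Excluding partial colourings up to permutations of the two
    sides and their exchange keeps this analysis short enough to be written
    down as a certificate, which a verified checker replays. *)

Require Import Defs.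
From mathcomp Require Import all_boot.

Set Implicit Arguments.
Unset Strict Implicit.
Unset Printing Implicit Defensive.

(** * Patterns *)

(* [(b, r, c)] prescribes the colour [b] for the edge between row [r] and
   column [c]. *)
Definition cell := (bool * nat * nat)%type.

Definition agrees (g : nat -> nat -> bool) (x : cell) :=
  g x.1.2 x.2 == x.1.1.

(** With [t] the two sides trade places; in both cases [f] moves the rows of the pattern and [h] its
    columns. *)
Definition place (t : bool) (f h : nat -> nat) (x : cell) : cell :=
  let: (b, r, c) := x in if t then (b, h c, f r) else (b, f r, h c).

(** A permutation of 0, ..., 7, kept as a function on [nat] so that placements compute. *)
Definition reindexing (f : nat -> nat) :=
  (forall i, i < 8 -> f i < 8) /\ {in gtn 8 &, injective f}.

Definition avoids (g : nat -> nat -> bool) (P : seq cell) :=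
  forall t f h, reindexing f -> reindexing h ->
    ~~ all (agrees g) (map (place t f h) P).

Definition avoids_all g (Ps : seq (seq cell)) :=
  forall P, P \in Ps -> avoids g P.

Definition pullback (g : nat -> nat -> bool) t (f h : nat -> nat) r c :=
  if t then g (h c) (f r) else g (f r) (h c).

Lemma agrees_place g t f h x :
  agrees g (place t f h x) = agrees (pullback g t f h) x.
Proof. by case: x => [[b r] c]; rewrite /agrees /pullback; case: t. Qed.

Lemma all_agrees_place g t f h P :
  all (agrees g) (map (place t f h) P) = all (agrees (pullback g t f h)) P.
Proof. by rewrite all_map; apply: eq_all => x; apply: agrees_place. Qed.

Lemma reindexing_comp f f' :
  reindexing f -> reindexing f' -> reindexing (f \o f').
Proof.
move=> [f8 fI] [f8' fI']; split=> [i i8|i j i8 j8 /= eqf].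
  by apply/f8/f8'.
by apply: fI' => //; apply: fI => //; rewrite unfold_in /= f8'.
Qed.

(** Placements compose: a placement in the pulled back colouring is one in [g]. If the inner one
    exchanges the sides, its rows pass through [h] and its columns through [f], hence the crossed
    compositions with [~~ t]. *)
Lemma avoids_pullback g t f h P :
  reindexing f -> reindexing h -> avoids g P -> avoids (pullback g t f h) P.
Proof.
move=> rf rh gP t' f' h' rf' rh'; rewrite all_agrees_place.
have [-> | ->] : t' = true \/ t' = false by case: t'; [left | right].
  have := gP (~~ t) (h \o f') (f \o h') (reindexing_comp rh rf')
             (reindexing_comp rf rh').
  by rewrite all_agrees_place; case: t.
have := gP t (f \o f') (h \o h') (reindexing_comp rf rf')
           (reindexing_comp rh rh').
by rewrite all_agrees_place; case: t.
Qed.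

(** The cycle of length 2k through row 0, column 0, row 1, column 1, ..., closed up by the
    modulus. *)
Definition cycle_pattern (b : bool) (k : nat) : seq cell :=
  [seq (b, i, i) | i <- iota 0 k] ++ [seq (b, i.+1 %% k, i) | i <- iota 0 k].

(** * Certificates *)

(* [Force t i d p]: the excluded pattern number [i], transposed if [t], is
   placed as [d] says, whose digits are alternately the images of the rows and
   of the columns 0, 1, ... of the pattern.  If one of its cells is not yet
   known to have the colour of the pattern, that cell gets the other colour
   and [p] goes on; if there is none, the case is closed.
   [Split r c p q] continues with [p] if the edge is red and [q] if blue. *)
Inductive cert :=
  | Done
  | Force of bool & nat & Decimal.uint & cert
  | Split of nat & nat & cert & cert.

(** Numerals are kept as raw digit strings: leading zeros survive, and one token lists many
    indices. *)
Definition uint_of_number (n : Number.uint) : option Decimal.uint :=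
  if n is Number.UIntDecimal d then Some d else None.

Declare Scope digits_scope.
Delimit Scope digits_scope with digits.
Number Notation Decimal.uint uint_of_number Number.UIntDecimal : digits_scope.
Bind Scope digits_scope with Decimal.uint.

Notation "i # d ; p" := (Force false i d p)
  (at level 98, d at level 0, right associativity).
Notation "i ^# d ; p" := (Force true i d p)
  (at level 98, d at level 0, right associativity).
Notation "{ r c ? p | q }" := (Split r c p q)
  (at level 0, r at level 0, c at level 0, p at level 98, q at level 98).

Fixpoint digits (d : Decimal.uint) : seq nat :=
  match d with
  | Decimal.Nil => [::]
  | Decimal.D0 d => 0 :: digits d
  | Decimal.D1 d => 1 :: digits d
  | Decimal.D2 d => 2 :: digits d
  | Decimal.D3 d => 3 :: digits d
  | Decimal.D4 d => 4 :: digits d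
  | Decimal.D5 d => 5 :: digits d
  | Decimal.D6 d => 6 :: digits d
  | Decimal.D7 d => 7 :: digits d
  | Decimal.D8 d => 8 :: digits d
  | Decimal.D9 d => 9 :: digits d
  end.

Fixpoint pairs (s : seq nat) : seq (nat * nat) :=
  if s is i :: j :: s' then (i, j) :: pairs s' else [::].

Definition cells (red blue : Decimal.uint) : seq cell :=
  [seq (true, p.1, p.2) | p <- pairs (digits red)]
    ++ [seq (false, p.1, p.2) | p <- pairs (digits blue)].

(* The digits may leave out rows and columns that the pattern does not use. *)
Definition complete (s : seq nat) := s ++ [seq i <- iota 0 8 | i \notin s].

Definition distinct8 (s : seq nat) := uniq s && all (gtn 8) s.

Lemma reindexing_complete s :
  distinct8 s -> reindexing (nth 0 (complete s)).
Proof.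
case/andP=> us s8.
have us' : uniq (complete s).
  rewrite cat_uniq us filter_uniq ?iota_uniq // andbT.
  by apply/hasPn => i; rewrite mem_filter => /andP[].
have sz : size (complete s) = 8.
  rewrite -(size_iota 0 8); apply/perm_size/uniq_perm; rewrite ?iota_uniq //.
  move=> i; rewrite mem_cat mem_filter mem_iota /=.
  by case: (boolP (i \in s)) => //= /(allP s8) /= ->.
split=> [i i8|i j i8 j8 /eqP].
  have : nth 0 (complete s) i \in complete s by rewrite mem_nth ?sz.
  by rewrite mem_cat mem_filter mem_iota => /orP[/(allP s8)|/andP[_ /andP[]]].
by rewrite nth_uniq ?sz // => /eqP.
Qed.

(** * The checker *)

(** A partial colouring. [None] marks an unknown edge, and so does a position beyond the end of a
    list; thus [[::]] knows nothing. *)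
Definition state := seq (seq (option bool)).

Definition lookup (S : state) r c := nth None (nth [::] S r) c.

Definition update (S : state) r c b : state :=
  set_nth [::] S r (set_nth None (nth [::] S r) c (Some b)).

Definition decided (S : state) (x : cell) :=
  if lookup S x.1.2 x.2 is Some b then ~~ (b (+) x.1.1) else false.

Definition compatible (g : nat -> nat -> bool) (S : state) :=
  forall r c b, lookup S r c = Some b -> g r c = b.

Lemma compatible_update g S r c b :
  compatible g S -> g r c = b -> compatible g (update S r c b).
Proof.
move=> gS gb i j b'; rewrite /lookup /update nth_set_nth /=.
case: eqP => [-> | _]; last exact: gS.
by rewrite nth_set_nth /=; case: eqP => [-> [<-] | _] //; apply: gS.
Qed.

Lemma compatible_decided g S x : compatible g S -> decided S x -> agrees g x.
Proof.
move=> gS; rewrite /decided /agrees.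
by case E: lookup => [b|] //; rewrite (gS _ _ _ E) negb_add.
Qed.

(** [Done] is rejected: every branch must be closed by a [Force] whose placed pattern is entirely
    decided, and the certificate after that [Force] is not inspected. *)
Fixpoint check (Ps : seq (seq cell)) (S : state) (p : cert) : bool :=
  match p with
  | Done => false
  | Force t i d p' =>
    let ds := pairs (digits d) in
    let rs := unzip1 ds in
    let cs := unzip2 ds in
    [&& i < size Ps, distinct8 rs, distinct8 cs &
        match [seq x <- map (place t (nth 0 (complete rs))
                                     (nth 0 (complete cs))) (nth [::] Ps i)
               | ~~ decided S x] with
        | [::] => true
        | [:: (b, r, c)] => check Ps (update S r c (~~ b)) p'
        | _ => false
        end]
  | Split r c p1 p0 =>
    check Ps (update S r c true) p1 && check Ps (update S r c false) p0
  end.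

(** Every placement of an avoided pattern fails at some cell, and that cell is not decided. So a
    fully decided placement is contradictory, and a single undecided cell must have the opposite
    colour. *)
Lemma check_sound Ps g p S :
  avoids_all g Ps -> compatible g S -> ~~ check Ps S p.
Proof.
move=> gPs; elim: p S => [|t i d p IH|r c p1 IH1 p0 IH0] S gS //=.
  apply/negP => /and4P[iPs /reindexing_complete rr /reindexing_complete rc].
  have := gPs _ (mem_nth [::] iPs) t _ _ rr rc.
  set Q := map _ _ => nQ.
  have agQ x : x \in Q -> ~~ agrees g x -> x \in [seq x <- Q | ~~ decided S x].
    move=> xQ; rewrite mem_filter xQ andbT.
    by apply: contraNN => /(compatible_decided gS).
  case/allPn: nQ => x xQ xg; move/(_ x xQ xg): agQ.
  case: filter => [|[[b r] c] [|//]] //; rewrite inE => /eqP xE chk.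
  suff gS' : compatible g (update S r c (~~ b)).
    by have := IH _ gS'; rewrite chk.
  apply: compatible_update => //; move: xg; rewrite xE /agrees /=.
  by case: (g r c); case: b {chk xE}.
apply/negP => /andP[chk1 chk0]; case E: (g r c).
  by have := IH1 _ (compatible_update gS E); rewrite chk1.
by have := IH0 _ (compatible_update gS E); rewrite chk0.
Qed.

Definition state_of (P : seq cell) : state :=
  foldr (fun x S => update S x.1.2 x.2 x.1.1) [::] P.

Lemma compatible_state_of g P : all (agrees g) P -> compatible g (state_of P).
Proof.
elim: P => [_ r c b|x P IH /= /andP[/eqP gx /IH gP]].
  by rewrite /lookup !nth_nil.
exact: compatible_update.
Qed.

(** A refuted pattern joins the list at its end, so earlier numbers stay valid. The empty pattern
    agrees with every colouring, so its exclusion is the contradiction sought. *)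
Fixpoint check_all (Ps : seq (seq cell)) (l : seq (seq cell * cert)) : bool :=
  if l is (P, p) :: l' then
    check Ps (state_of P) p && check_all (rcons Ps P) l'
  else [::] \in Ps.

Lemma check_all_sound Ps l g : check_all Ps l -> ~ avoids_all g Ps.
Proof.
elim: l Ps => [|[P p] l IH] Ps /=.
  have rid : reindexing id by split=> [|i j _ _].
  by move=> Ps0 /(_ _ Ps0 false id id rid rid).
case/andP=> chk /IH{}IH gPs; apply: IH => Q.
rewrite mem_rcons inE => /orP[/eqP -> {Q} | /gPs //].
move=> t f h rf rh; rewrite all_agrees_place; apply/negP => gP.
(* The certificate treats [P] in its standard position only; any other position is standard for a
   pulled back colouring, which avoids the same patterns. *)
have gPs' : avoids_all (pullback g t f h) Ps.
  by move=> Q /gPs; apply: avoids_pullback.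
by have := check_sound p gPs' (compatible_state_of gP); rewrite chk.
Qed.

(** * The certificate of the upper bound *)

Definition excluded_cycles := [:: cycle_pattern true 5; cycle_pattern false 4].

(* Patterns 0 and 1 are those of [excluded_cycles]; the others carry their
   number. The last pattern of each list is the red cycle that the list
   excludes, and in [red_C4_cert] the empty pattern. *)
Definition no_red_C8_cert : seq (seq cell * cert) := [::
(* 2 *) (cells 0004101121223233 0105121542434451, 1#51051244; 1#51051243;
  0#0011223354; Done);
(* 3 *) (cells 000102101216212233364045555761 050724254344, 0#6122001633;
  0#6102104557; 1#05244367; Done);
(* 4 *) (cells 000304061011212232334045 051524253544464754, {0 7 ? {1 6 ?
  0#4016033221; 0#4006112233; {0 1 ? {1 3 ? {3 1 ? 0#4006133122; {0 2 ? {1 2 ?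
  {3 6 ? {6 1 ? 0#6122001633; 0#6122001336; 0#6102331045; 1#54256643;
  1#54256346; 0#0011223356; Done | {5 1 ? 0#5122001633; 0#5102331045;
  1#61442553; 1#61435524; 0#0011223364; Done | {2 3 ? {2 6 ? {5 2 ?
  0#5201231045; 0#5200112633; 1#61442553; 1#61435524; 0#0011223364; Done |
  1#61425425; 0#6540112204; 0#6540011322; 0#6540011223; 1#51426425;
  0#5540011226; 0#5540011223; {7 0 ? 0#7011223304; 0#7001122633; 1#41526374;
  Done | {2 0 ? {7 1 ? 0#7102132045; 0#7100132632; 1#24415275; Done |
  1#71425463; 1#71425364; 0#0011223374; Done} | 1#70244156; 1#70244153;
  0#0011223376; Done}}} | 1#61542647; 1#61542643; 0#0011223367; Done} |
  1#61542347; 1#61542346; 0#0011223667; Done}}} | 1#54253647; 1#54253643;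
  0#0011223357; Done} | 1#54251246; 1#54251243; 0#0011223356; Done} |
  1#54250246; 1#54250243; 0#0011223356; Done} | 1#54253146; 1#54253143;
  0#0011223356; Done} | 1#54251346; 1#54251341; 0#0016512233; Done} |
  1#54250146; 1#54250143; 0#0011223356; Done} | 1#54251647; 0#5703322110;
  0#5700112233; 1#35164450; 1#46152453; 0#1122304307; 0#1122304304;
  0#3221104306; 1#14253647; Done} | 1#54250746; 0#5603322110; 0#5600112233;
  1#35074450; 1#47052453; 0#1122304304; 0#3221104306; 0#3221104304; 1#05143647;
  Done});
(* 5 *) (cells 0003041011212232334045 0515242535444654, {4 7 ? 0#0332211047;
  0#1122330047; 1#07152446; 1#17052446; 0#2233061047; 0#4016033221;
  0#4006112233; 1#05172441; 1#15072443; 1#35072446; 1#35072441; 0#4003163122;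
  1#05172442; 1#15072442; {5 1 ? 0#5122001633; 0#5102331047; 1#05244357; Done |
  1#51442705; 1#51442507; 0#5540011233; 3#0011223344557667; 3#0012213344557667;
  3#0011223344556677; 1#61724453; 1#61724354; 0#0011223364; Done} |
  4#0011223344556776; 4#0011223344556677; 1#15244706; 1#15244607; 1#35244706;
  1#35244607; 1#54250746; 1#54250647; 0#0016573221; 0#2116573300; 0#4003365711;
  0#4003361122; 0#5633001122; 0#5611223300; 1#01425025; Done});
(* 6 *) (cells 000102101213212233344045555761 050715162426, 0#6122001334;
  0#6102104557; 1#05162467; Done);
(* 7 *) (cells 0003041011212232334045 05152425354454, 5#00112233445567;
  5#00112233445566; 0#0332211047; 0#0332211046; 0#1122330047; 0#1122330046;
  1#54250716; 1#54250617; 0#2233004756; 0#2233004657; 0#3221104756;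
  0#3221104657; 0#5640112233; 0#5640033221; 1#05162451; 1#15063724; 1#15062453;
  1#35062451; 1#35061724; 1#54260715; 0#4003143122; 0#4001223413; 1#05162442;
  1#15062442; 6#0011223344557667; 6#0012213344557667; 6#0011223344556677;
  1#61724453; 1#61724354; 0#0011223364; Done);
(* 8 *) (cells 000104101113162122323340455464 14152444506061637173,
  0#4001223316; 0#5401223316; 0#6401223316; 1#24465063; 1#46506173; 1#50664415;
  0#0011234554; Done);
(* 9 *) (cells 01030410132122323340 020506151617242544, 1#44251602; 1#44250617;
  0#3310422104; 0#3221031047; 1#05243716; Done);
(* 10 *) (cells 0003041011212232334045 0515243544, {2 5 ? 0#0332254011;
  0#1125400332; 0#1045223304; 0#4522330011; 0#4521100332; 1#35014214;
  0#1045223403; 0#4011223403; 2#004522331451; 2#001122334455; 0#0011552233;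
  Done | 7#001122334465; 7#001122334475; 7#001122334455; 0#5403322110;
  0#5400112233; 0#6403322110; 0#6400112233; 0#7403322110; 0#7400112233; {1 4 ?
  0#4014033221; 0#5410033221; 0#6410033221; 1#24415063; 1#50614425;
  0#0045541123; Done | {1 3 ? 0#5400133221; 0#6400133221; 0#7400133221; {0 1 ?
  8#0011223344556776; 8#0011223344556677; {0 2 ? 0#5402211045; 0#7402211045;
  1#35516370; 1#50617517; 1#50617516; 1#60517517; 1#60517516; 0#3011045766;
  0#4011045766; 0#4011045667; 1#14253647; Done | 9#0011223344556776;
  9#0011223344556677; 0#4011223307; 0#4011223306; 1#35241746; 1#46142502;
  0#0042211336; Done} | 1#24150153; 1#44150153; 1#50637105; 0#0011234554; Done}
  | 1#35241350; 1#50631425; 0#0455403221; 0#2110455403; 0#3304554011;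
  0#3221104554; 1#01341325; Done}}});
(* 11 *) (cells 0003041011212232334045 05152444, {3 5 ? 0#0335401122;
  0#1122354004; 0#1122354003; 0#4533001122; 0#4532211003; 1#24150243;
  1#24134205; 0#0322354011; 0#1123004532; 0#3540112304; 1#34134201;
  10#233110450254; Done | 10#001122334455; Done});
(* 12 *) (cells 0003041011212232334045 2444, 0#0332211045; 0#1122330045;
  11#001122334455; Done);
(* 13 *) (cells 000304101121223233405564 2435444546476061626366, {3 0 ? {3 1 ?
  {5 1 ? 0#1003322155; 0#2233001155; 0#6400322155; 1#15244663; 1#15244662;
  0#0013322155; 0#5122103304; 1#54256647; 1#54254663; 1#54254662; 0#0011223357;
  0#1031225304; 0#6400112257; 1#05144667; Done | {2 0 ? {2 3 ? {3 6 ? {4 2 ?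
  0#0321104236; 0#1122400336; 0#1042213304; 0#3110422304; 1#06143547;
  1#45341663; 1#51664534; 0#2011330455; 0#3011224307; 1#14253746; Done |
  11^#003223114456; Done} | 1#51663547; 1#51663544; 0#1021330457; 0#1021330455;
  0#2011330455; 0#3011230457; 1#15244637; Done} | 1#35442366; 1#51664423;
  1#51632446; 0#0011223653; Done} | 1#35442066; 1#51664420; 1#51602446;
  0#0336501122; 0#0011223655; 0#2110033655; 0#5633001122; 1#02516025; Done}} |
  1#24466135; 0#5522330011; 0#5521100332; 1#31526645; Done} | 1#24466035;
  0#5522330011; 0#5521100332; 1#35466251; 1#51603544; 0#0011322554; Done});
(* 14 *) (cells 000304101121223233405564 24444546476063, {6 1 ? 0#1004612233;
  0#1003322164; 0#2233046110; 0#4011640332; 0#4004612233; 1#20631445;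
  1#60241345; 1#60241342; 0#0011256233; Done | {6 2 ? 0#2110046233;
  0#3304622110; 0#3300112264; 0#4011226403; 1#30632445; 1#60342345;
  0#0011223564; Done | {3 5 ? 0#5533001122; 0#5532211004; 0#5532211003;
  0#6400112235; 1#24526546; 1#24456253; 0#5533001126; 0#5532230011; 1#24465165;
  11^#003352114426; Done | 13#0011223344556776; 13#0011223344556677;
  0#1122330467; 0#1122330466; 0#3221100467; 1#24461735; 1#24453716;
  0#1126640332; 0#1004662233; 0#3304662110; 0#3226640011; 0#5522330011;
  0#5521100332; 1#12513063; Done}}});
(* 15 *) (cells 000304101121223233405564 2444454647, 0#6403322110;
  0#6400112233; 14#0011223344556677; Done);
(* 16 *) (cells 000304101121223233405566 244445464751546474, {6 0 ?
  0#0332211066; 0#1122330066; 11#001122336446; Done | {5 3 ? 0#0011223355;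
  0#3221100355; 14^#3001122345665477; Done | {5 0 ? 0#0332211055; 0#1122330055;
  11#001122335445; Done | {1 4 ? 0#4014033221; 0#4004112233; 1#24605145;
  1#74605341; 1#74605145; 0#0011752233; Done | {1 3 ? {2 3 ? {3 4 ?
  0#4004331122; 0#4004322311; 0#4004322113; 1#74605143; 1#74605142;
  0#0011227334; Done | {3 1 ? {4 1 ? {0 1 ? {0 5 ? 0#1041223305; 0#2231401305;
  0#3221401305; 1#50641547; 1#50641546; 1#60541547; 0#1041055667; 0#3110055766;
  1#14253647; Done | {0 2 ? {0 6 ? 0#1041223306; 0#2140133206; 0#3140132206;
  0#6600132231; 1#26145160; 1#36145160; 1#50641647; 1#60541647; 1#60541645;
  0#1021066557; 0#2011066755; 0#3011066755; 1#14253647; Done | 1#50644506; {0 7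
  ? 0#1041223307; 1#24174605; 1#34174506; 0#0011255632; Done | 1#50644507;
  1#60544507; {1 5 ? 0#2140023315; 0#3100155766; 1#05243647; Done | 1#24150746;
  1#34150647; 0#0011265732; Done}}} | 1#50644502; 1#60544502; 0#0011233266;
  0#1001233266; 0#1001233255; 0#2100133266; 0#2100133255; 1#05142647;
  1#34150647; 1#45061453; 1#44152602; 0#0011224337; Done}} | 1#01506447;
  1#01506446; 1#01506445; 0#1041223307; 0#2231401305; 0#3221401306;
  0#3221401305; 1#14253647; Done} | 1#24605145; 1#34605146; 1#74605146;
  1#74605145; 0#0011257633; Done} | 1#31506446; 1#31506445; 1#60513447;
  1#60513445; 0#0011223665; 0#0011223567; 0#1003223665; 0#2110033566;
  1#05142647; Done}} | 1#23506446; 1#23506445; 1#60532447; 1#60532445;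
  0#0013322665; 0#0013322567; 0#1003322665; 0#3300112567; 0#3300112566;
  1#05144637; Done} | 1#13506446; 1#13506445; 1#60531447; 1#60531445;
  0#0332211665; 0#0332211566; 0#2233001665; 0#6510033221; 1#05241351;
  1#50642506; 1#74250647; 1#74135061; 0#0015566771; Done}}}}});
(* 17 *) (cells 000304101121223233405566 24444546476474, {5 4 ? 0#5403322110;
  0#5400112233; 14#0011223344665577; Done | 16#0011223344665577;
  16#0011223344556677; 0#1003322166; 0#1003322155; 0#2233001155; 1#54251647;
  1#64251647; 0#0332216755; 0#0332215766; 0#1003322157; 0#2233001157;
  1#05172446; Done});
(* 18 *) (cells 0003041011212232334055 2444454647, 15#0011223344557667;
  15#0011223344556677; 17#0011223344556776; 17#0011223344557667;
  17#0011223344557766; 17#0011223344556677; 1#24667745; 0#5522330011;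
  0#5521100332; {0 5 ? 0#4011250332; 0#5500112233; 1#24664253; 1#52466774;
  1#64764253; 1#64764251; 0#0011632554; Done | 1#05446776; 1#05446677; {0 2 ?
  0#5521100233; {1 2 ? 0#5521123307; 0#5521123306; 0#5521123304; 1#64567745;
  1#64467752; 1#74566745; 1#74466753; 0#0011226573; Done | {1 3 ? 0#5521133207;
  0#5521133206; 0#5521133204; 1#64567745; 1#64467752; 1#74566745; 1#74466753;
  0#0011226573; Done | {1 4 ? 0#4004112233; 0#5522330014; 1#12546643; Done |
  1#46641352; 1#46641251; 1#52144766; 0#0011422556; Done}}} | 1#52054664;
  1#64764502; 1#64450251; 0#0011622554; Done}});
(* 19 *) (cells 00030410112122323340 2444, 12#001122334456; 12#001122334457;
  12#001122334455; 18#0011223344566577; 18#0011223344655677;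
  18#0011223344665577; 18#0011223344675576; 18#0011223344755667;
  18#0011223344765567; 18#0011223344775566; 18#0011223344556677; 1#55667744;
  1#65567744; 1#75566744; 0#5403322110; 0#6403322110; 0#6400112233;
  0#7400112233; 1#45506376; Done);
(* 20 *) (cells 00030410112122323340 44, 19^#0033221144; 19#0011223344;
  0#0332401124; Done);
(* A red [C8] with pendant edges at two adjacent vertices: joining their outer ends in red would
   give a red [C10], and in blue gives pattern 20. *)
(* 21 *) (cells 00030410112122323340 Decimal.Nil, 0#4011223304; 20#0011223344;
  Done);
(* 22 *) (cells 000304101121223233415566 404345505360637073, {4 4 ?
  0#1004412233; 0#1003322144; 0#2233044110; 0#2233001144; 1#14205345;
  1#24135045; 0#0332251144; Done | {1 5 ? 0#5511223304; 0#5510033221;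
  1#60735445; 1#60734451; 0#0015612233; Done | {1 2 ? {1 3 ? {1 4 ?
  20#1122330440; Done | 1#50634514; 1#60534514; 1#60534415; 1#70534415;
  0#5400133221; 0#6554001122; 0#6400133221; 0#7554001122; 1#40516273; Done} |
  1#50631544; 1#60531544; 0#1122330466; 0#2112330466; 0#2112330455; 1#13504526;
  Done} | 1#50634512; 1#60534512; 1#70534512; 0#2110033266; 0#2110033255;
  0#3300112266; 0#3300112255; 0#4110033266; 1#15264053; 1#25364350; 1#35264350;
  1#60534625; 0#5562200311; 0#6552200311; 0#7221103304; 1#40516374; Done}}});
(* 23 *) (cells 000304101121223233415566 4043505360637073, 22#0011223344665577;
  22#0011223344556677; 0#5541223304; 0#5541100332; 0#6641223304; 0#6641100332;
  1#40735264; 1#70435462; 1#70435264; 0#0011447233; Done);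
(* 24 *) (cells 0003041011212232334155 4043505360637073, 23#0011223344556776;
  23#0011223344557667; 23#0011223344557766; 23#0011223344556677; 1#40536776;
  1#40536677; 1#50436776; 1#50436677; 0#0332214657; 0#0332214655; 0#3300114756;
  0#3300114655; 1#05366077; Done);
(* 25 *) (cells 00030410112122323341 4043505360637073, 24#0011223344655677;
  24#0011223344665577; 24#0011223344765567; 24#0011223344556677; 1#40556673;
  Done);
(* 26 *) (cells 000304101121223233 Decimal.Nil, 21#0332211044; 21#0011223354;
  21#0332211054; 21#0011223364; 21#0332211064; 21#0011223374; 21#0332211074;
  21#0011223344; 25#0011223354456677; 25#0011223364455677; 25#0332211064455677;
  25#0332211074455667; 1#40516273; Done);
(* Pattern 26 is the red [C8] with one pendant edge. Without it, the edges from the four rows of the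
   cycle to the other columns are blue and contain a blue [C8]. *)
(* 27 *) (cells 0003101121223233 Decimal.Nil, 26#0011223347; 26#1003322144;
  26#1003322145; 26#2110033245; 26#2110033246; 26#3221100346; 26#3221100347;
  26#0011223344; 1#04152637; Done)].

(** The list ends with a red [C6] together with two disjoint blue edges (56), one (57) and none
    (58). Each exclusion makes red all edges disjoint from the next configuration, and these contain
    a red [C8]. *)
Definition no_red_C6_cert : seq (seq cell * cert) := [::
(* 28 *) (cells 000210111421222466 030616263033404455, {0 5 ? {1 5 ? {2 5 ? {5
  0 ? 27#50022411; 27#50022114; 1#03304451; 1#54403306; 27#66500221;
  27#66500122; 27#66500115; 1#30445165; 1#30445162; 27#00112235; Done | {0 4 ?
  {1 2 ? {4 1 ? 27#41100422; 27#41100225; 1#45503306; 1#55403306; 27#56411004;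
  27#56411002; 27#66411005; 27#66411004; 27#66411002; 1#30445562; 1#30425564;
  27#00112234; Done | {0 1 ? {4 2 ? 27#42001125; 1#45503306; 1#55403306;
  27#56420014; 27#56420011; 27#66420015; 27#66420014; 1#30415564; 1#30415465;
  27#00112435; Done | {5 1 ? 27#51001422; 27#51001224; 1#52403306; 27#66510015;
  27#66510014; 27#66510012; 1#30445562; 1#30425564; 27#00112234; Done |
  1#51403306; {5 2 ? 27#66520015; 27#66520014; 27#66520011; 1#30516442;
  1#30415564; 27#00112234; Done | {5 4 ? 27#66540015; 27#66540012; 27#66540011;
  1#30516244; 1#30415562; 27#00112234; Done | {6 0 ? 27#60011422; 27#60011224;
  1#30415462; 1#30415264; 27#00112234; Done | {3 1 ? 27#31001422; 27#31001224;
  1#60344152; 1#60324154; 27#00112264; Done | 1#60314452; 1#60314254;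
  27#00112264; Done}}}}}} | 1#26014033; 1#33014055; 1#41033055; 1#50330144;
  27#35001221; 27#45001122; 27#54001123; 27#54001122; 1#01304253; Done}} |
  1#40330612; 1#50330612; 27#42001421; 27#52001421; 27#52001124; 1#41503306;
  27#66420015; 27#66420014; 1#30415564; 1#30415465; 27#00112435; Done} |
  1#16044033; 1#26044033; 1#33044055; 1#44033055; 27#35001321; 27#45001321;
  27#45001122; 1#50330442; 1#50314403; 27#00112352; Done}} | 1#40330625;
  1#55260330; 27#45001421; 27#50051122; 27#50022411; 27#50022114; 1#03304154;
  1#33062554; 1#33062552; 27#00112234; Done} | 1#55160330; 27#50022411;
  27#50022114; 1#33061554; 1#33061551; 27#00113422; Done} | 1#55033044;
  27#54211002; 27#54112200; 27#54100221; 1#16055033; 1#26055033; 1#40330552;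
  1#40330551; 27#00132142; Done});
(* 29 *) (cells 00021011212266 03062633404455, {1 6 ? 27#66112200; 27#66100221;
  {0 1 ? 27#66100122; {2 0 ? {3 2 ? 27#32002116; {0 5 ? 27#32201105;
  27#66102105; 1#03356044; 1#26356044; 1#40653306; 27#32042110; 27#46100221;
  27#66100124; 1#55304164; 1#55304162; 27#00112254; Done | {0 4 ? 27#32201104;
  27#66102104; 1#40643603; 1#40643306; 1#40643305; 1#55033462; 1#55033461;
  1#55033440; 27#20115204; 27#20011643; 27#32001645; 27#50022116; 1#03243556;
  Done | 1#55044061; 1#60440633; 27#20011663; 27#51022016; 1#23365504;
  1#33265504; 27#00112432; Done}} | 1#03326044; 1#40623306; 27#46100221;
  27#46100122; 27#66102104; 1#26033244; {0 5 ? 27#46102105; 27#66102105;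
  1#55423306; 27#56110220; 27#56100221; 1#32405165; 1#32405164; 27#00112435;
  Done | 1#55033244; 1#55033241; 27#00115422; Done}} | 1#33062062; 1#33062061;
  1#33062044; 27#00112234; 27#31220016; 1#03362044; Done} | 1#26016044;
  1#33016044; 27#34220016; 27#34220011; 27#34211002; 1#03316044; 1#40610336;
  1#40610332; 27#00164224; Done} | {3 0 ? {2 0 ? {3 5 ? 27#02211035;
  27#11220035; {0 4 ? 27#30112204; 1#55160334; 1#55033440; 27#02211054; Done |
  1#55160440; {0 7 ? 27#30112207; 27#50112207; 1#03375516; Done | {1 3 ?
  27#50022113; 1#26155307; 1#26155304; 1#33551607; 1#33551604; 1#44061553;
  27#02243011; 27#11243002; 27#10022734; 27#34220011; 27#34211002; 27#43102435;
  1#01321445; Done | {0 1 ? 27#22011035; 1#33152607; 1#33152604; 1#44031625;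
  1#44031526; 1#55261307; 1#55261304; 27#11003754; 27#66453450; 27#66453057;
  1#03144067; Done | {1 2 ? 27#21120035; 1#33152604; 1#55261304; 1#55261301;
  27#00345112; Done | {1 4 ? 27#30022114; 27#50022114; 1#03345516; Done | {2 3
  ? {2 5 ? 27#35220011; 27#35211002; 1#44013312; 1#44013213; 27#00112342; Done
  | 1#44052613; 1#44052612; 27#00112342; Done} | 1#33261401; 1#33260514;
  1#55032614; 1#55032612; 27#00113452; Done}}}}}}} | {3 4 ? 27#02211034;
  27#11220034; 1#26140335; 1#44160335; 1#55330614; 1#55330440; 27#34500221;
  27#45220011; 1#03314416; Done | {3 7 ? 27#02211037; 27#11220037; 1#26170335;
  1#44330716; 1#44330617; 1#55330716; 1#55330617; 27#46573011; 27#56473011;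
  27#56473002; 27#66473025; 27#66473002; 1#34415265; Done | {4 6 ? {1 2 ? {3 6
  ? 27#46301122; 27#46300211; 27#66301122; 27#66300211; 1#03344261; 1#55344261;
  1#55344162; 27#51021036; 1#44355603; 1#44330655; 27#11003645; 27#11003643;
  27#21003645; 27#51003643; 1#03162534; 1#53061534; 27#00112254; Done | {1 4 ?
  {0 4 ? 28#04112233405566; Done | 1#55330440; 27#50022114; 1#16045533;
  1#26045533; 1#26033554; 1#44553603; 27#30021321; 27#43100221; 27#66431120;
  27#66431024; 1#03314064; Done} | 1#44160337; 1#44160335; 1#55361440;
  1#55341603; 1#55330614; 27#02112054; 27#11220053; 27#21120054; 27#21120053;
  1#03142637; 1#23041635; 27#00112547; Done}} | 1#44330612; 1#55330612;
  27#30112246; 27#66422110; 27#66420011; 1#03344061; 1#55344061; 1#60443612;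
  1#60443603; 27#10012263; 27#20015263; 27#51002246; 1#03165534; 1#23065534;
  27#00115224; Done} | 1#55344603; 1#55330644; 1#55330640; 27#02211054;
  27#11220054; 27#11220053; 1#03164437; 1#26031435; 1#44061337; 1#44061335;
  27#00112547; Done}}}} | 1#33062044; 27#02211034; 27#11220034; 1#14402603;
  1#20441603; 1#40261403; 27#30022311; 27#43100221; 1#03314026; Done} |
  1#16033044; 1#26033044; 28#00112233445566; Done}});
(* 30 *) (cells 00021011212266 030633404455, {2 6 ? 27#66220011; 27#66211002;
  {6 0 ? 27#02266011; 27#11266002; 27#11220066; 1#33061261; 1#33016216;
  27#00113622; Done | 29^#00221144335566; Done} | 29#00112233445566; Done});
(* 31 *) (cells 00021011212266 030633404455, 30#00112233445566; Done);
(* 32 *) (cells 000210112122 030633404455606676, 1#33066044; {0 4 ?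
  27#34022110; 1#66033044; 1#76033044; 27#64001122; 27#74001122; 1#03306276;
  Done | 1#76604403; 30#00112266445573; Done});
(* 33 *) (cells 000210112122 030633404455, 31#00112233445576;
  31#00112233445566; 32#0011223344557667; 32#0011223344556677; {3 0 ? {6 5 ?
  27#02211065; 30#00112233447665; Done | {0 4 ? 27#30112204; 27#60112204;
  27#70112204; 1#03347665; 1#33067465; 27#02211035; Done | 1#55660440; {0 5 ?
  27#30112205; 27#70112205; 1#66753304; 1#76653304; 27#64700221; 27#74600221;
  1#03356176; Done | {0 7 ? 27#30112207; 27#50112207; 1#03375566; Done | {1 3 ?
  27#50022113; 27#70022113; 1#33556607; 1#33556604; 1#44056673; 1#53766504;
  27#11220037; 27#11220034; 27#34500221; 27#43100221; 1#03314417; Done | {1 4 ?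
  27#30022114; 27#50022114; 1#03345566; Done | 1#33140665; 1#33140566;
  1#44130665; 1#44130566; 1#55660413; 1#76650413; 1#76650314; 27#21105374;
  27#21103645; 27#53703546; 1#03142556; Done}}}}}} | 1#66033044; 1#76033044;
  27#02211064; 27#11220064; 27#64700221; 1#14403306; 1#30440661; 1#40330661;
  1#66044033; 1#76044033; 27#11220063; 27#31106374; 27#41220016; 1#03143046;
  Done});
(* 34 *) (cells 000210112122 030633404455, 33#00112233445566; Done);
(* 35 *) (cells 00020607101121226070 033340414244556466677677, {0 4 ?
  27#70112204; {0 5 ? 27#60112205; 1#55667442; 1#55667441; 1#55667440;
  27#10512207; 27#10512204; 27#21105205; 27#21105204; 27#50112206; 1#14255667;
  Done | 33#00112233446655; Done} | 1#33046776; 1#33046677; 27#11220736;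
  27#11220637; 27#21100736; 1#26176403; 1#76176442; 1#76176403; 27#00112372;
  Done});
(* 36 *) (cells 0002060710112122466070 033340445566677677, 27#46001122; {4 1 ?
  27#22064110; 27#22001146; 27#60064122; 1#20426776; Done |
  35#0011223344557667; 35#0011223344556677; 27#02211064; 27#64701122;
  27#64700221; 1#33044166; 1#33044162; 27#00112236; Done});
(* 37 *) (cells 000210112122 0333404455, 34#00112233445567; 34^#00221144335566;
  34^#00221144335567; 34#00112233445566; 27#60112207; 27#60112206; 27#70112207;
  27#70112206; 36#0011223344556776; 36^#0022114433556677; 1#03667744;
  1#33667744; 1#33667740; 27#02211034; Done);
(* 38 *) (cells 00020710112122404250 0304154455, 27#11224007; 27#40112207;
  27#50112207; 1#15574403; 1#55174403; 27#00531122; Done);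
(* 39 *) (cells 0002101121223540425052 0304153343444655, {0 6 ? 27#11224006;
  27#50112206; 1#15564403; 1#55164403; 27#00531122; Done | 38#4011223304556677;
  38#0011223344556677; {1 3 ? 27#50022113; 1#15530644; 1#15530447; 1#15530446;
  27#50022117; 27#50022116; 27#50022114; 1#33064754; 1#33044756; 27#22001634;
  27#22001435; 1#03442556; Done | 1#55130644; 1#55130446; 27#11220054;
  27#21100256; 27#21100254; 1#03142647; Done}});
(* 40 *) (cells 00021011212240425052 03043343444655, {3 5 ? 39#02211033445566;
  39#00112233445566; 27#35100221; 27#40022115; 27#50022511; 1#03315544; Done |
  1#55330446; 27#00112256; 27#11220056; 27#21100256; 1#16044335; 1#26044335;
  27#00422511; 27#50022511; 1#01553344; Done});
(* 41 *) (cells 00021011212240425052 033343444655, 40#00112233465564;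
  40#00112233445566; 27#11224006; 27#11224004; 27#21104206; 27#21104204;
  27#50112206; 27#50112204; 1#03441655; 27#11224005; 27#21104205; 1#24155643;
  1#54152643; 27#00112352; Done);
(* 42 *) (cells 00021011212240425052 0333434455, 41#00112233445567;
  41#00112233445566; 27#00112247; 27#11220047; 27#11220046; 27#21100246;
  27#50112246; 1#26170344; 1#56170344; 27#00112452; Done);
(* 43 *) (cells 000210112122 03334455, 37#022110334455; 37#001122335544;
  37#022110335544; 37#001122334455; 42#001122335544; 42#001122334455;
  27#10435221; Done);
(* 44 *) (cells 000210112122 03334455, 43#001122334455; Done);
(* 45 *) (cells 0001021113152122555657656667757677 03040626335051606162707172,
  27#56677513; 27#66577513; 27#76576513; 1#26035160; 1#33516270; 1#33506271;
  1#33506172; 1#50617304; 1#60517304; 1#70516304; 27#00223115; 27#15566774;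
  27#15546776; 27#20023113; 27#20011554; 27#30022115; 27#30011556; 1#03241635;
  Done);
(* 46 *) (cells 00021011152122555657656667757677
  03060726273344505152606162707172, {0 1 ? {0 4 ? 27#55112204; 1#44516270;
  1#44506172; 27#00422115; 27#21104204; 27#21024015; 27#40011556; 1#33052644;
  1#33052452; 27#00112234; Done | 45#0011224433556677; 45#0011223344556677;
  1#33140726; 1#33140627; 1#44130726; 1#44130627; 27#36475510; 27#46375511;
  1#03305144; Done} | 1#33015260; 1#33015062; 1#50627103; 1#60527103;
  1#70526103; 27#00322115; 27#15566773; 27#15536776; 27#30155367; 27#30022115;
  1#03162735; Done});
(* 47 *) (cells 00021011152122555657656667757677 0333445160, 27#00155766;
  27#00155667; 27#21155766; 27#21155667; 27#56651002; 27#55112200; 27#66551002;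
  27#65100221; 27#76551002; 27#75112200; 27#75100221; 46#0011223344556677;
  Done);
(* 48 *) (cells 00021011212225555657656667757677 0316173344505152606162,
  27#00112557; 27#00112556; 27#76552110; 27#75220011; 27#75211002;
  46#0221103344556677; Done);
(* 49 *) (cells 00051011212255667677 0306151617252733505160617172, 1#33061725;
  1#33061527; 27#35001122; 1#50617233; 1#60517233; 27#35536677; Done);
(* 50 *) (cells 000205101112212255566667757677 031516172526334450516061,
  27#75022110; 27#75001221; 27#75001122; 49#0011223344556776; 43#055667334470;
  Done);
(* 51 *) (cells 000210111221225556656667757677 03151617252627334450516061,
  50#0011223344566577; 50#0011223344556677; 1#33061725; 1#33051627;
  43#355677034460; Done);
(* 52 *) (cells 000210112122555657656667757677 031516173344515260, {5 0 ?
  27#00566775; 27#00556776; 27#21105665; 27#21105567; 27#21105566; 27#65500221;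
  27#75501122; 27#75500221; 1#33061725; 1#33051726; 1#33051627; 27#35501122;
  27#75366750; 1#51607233; 1#60715233; 27#35536677; Done | {6 1 ? 27#00116655;
  27#00116557; 27#00116556; 27#21665775; 27#21655776; 27#21655677; 27#75566122;
  1#33061725; 1#33051726; 1#33051627; 27#35567761; 27#35566122; 27#35566110;
  27#75365761; 1#03305271; 1#15033052; 1#25033150; 1#60517233; 27#55367763;
  27#75365763; 1#60315372; 46#3566577344021021; Done | {6 2 ? 27#00112266;
  27#00112265; 27#21100267; 27#21100266; 27#21100265; 27#75566221; 1#33061725;
  1#33051726; 1#33051627; 27#35567762; 27#75365762; 1#50617233; 1#60517233;
  27#35536677; Done | 48#0011223344566577; 48#0011223344576576;
  48#0011223344556677; 51#0221103344556677; 51#0011223344556677; 1#12516025;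
  Done}}});
(* 53 *) (cells 000210112122555657656667757677 0333445160, 47#0011223344566577;
  47#0011223344576576; 47#0011223344556677; {5 2 ? 27#00112257; 27#00112256;
  27#00112255; 27#21100257; 27#21100256; 27#21100255; 27#65520011; 27#75522110;
  27#75520011; 1#33061725; 1#33051726; 1#33051627; 27#35667752; 27#35522110;
  27#35520011; 27#65367752; 27#75366752; 1#03306271; 1#15033062; 1#25033160;
  1#51607233; 27#10012253; 27#75366753; 52#1100227344355667; Done |
  52#0011223344556677; Done});
(* 54 *) (cells 000210112122555657656667757677 03334451, 53#0221103344557667;
  53#0011223344556677; 27#00655672; Done);
(* 55 *) (cells 000210112122 033344, 44#001122334456; 44#001122334457;
  44#001122334465; 44#001122334466; 44#001122334467; 44#001122334475;
  44#001122334476; 44#001122334477; 44#001122334455; 54#0011223344655677;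
  54#0011223344556677; 27#00115665; 27#00115566; 27#10022157; 27#10022156;
  27#10022155; 27#21566775; 27#21556776; 27#21556677; 1#33061725; 1#33051627;
  27#35516677; Done);
(* 56 *) (cells 000210112122 3344, 55#2110023344; 55^#1100223344;
  55^#2001123344; 55#0011223344; 27#00113223; Done);
(* 57 *) (cells 000210112122 33, 56#0011223347; 56#0011223354; 56#0011223355;
  56#0011223365; 56#0011223366; 56#0011223376; 56#0011223377; 56#0011223344;
  27#44556677; Done);
(* 58 *) (cells 000210112122 Decimal.Nil, 57#00112236; 57#00112243;
  57#00112244; 57#00112254; 57#00112255; 57#00112265; 57#00112266; 57#00112233;
  27#33445566; Done)].

(** Pattern 86 is a red [C4] with a red and a blue edge, all disjoint. Without it, a red [C4] and a
    disjoint blue edge (87) leave a blue [C8] on the other vertices; without 87, a red [C4] leaves a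
    red [C6]. *)
Definition no_red_C4_cert : seq (seq cell * cert) := [::
(* 59 *) (cells 000106101133404244 0203041213142255, 58#401106; {2 5 ? {1 5 ?
  58#251100; 58#251044; 58#251006; 58#400115; 1#02142645; 1#46220413;
  1#55462402; 1#55462204; 1#55462203; 58#250043; 58#335240; 58#334254;
  1#02132034; Done | {0 5 ? 58#250044; 58#250011; 1#55130422; 1#55120421;
  58#004251; Done | {2 0 ? 58#201106; 1#46220413; 1#46220315; 1#55031226;
  58#334520; 58#334025; 58#560110; 58#560043; 1#02135035; Done | 1#55031220;
  58#501106; 1#22031556; 1#46550213; 58#260011; 58#334006; 58#334001;
  58#400625; 1#02213645; Done}}} | 1#55220413; 1#55220314; 58#335442;
  58#544006; 1#13022556; 1#46552203; 58#334001; 58#400611; 1#22314655; Done});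
(* 60 *) (cells 000105101125404244 020304121314223155, 58#250044; 58#250011;
  58#401105; 1#31240312; 1#31220314; 58#324005; 1#45312203; 1#55312204;
  1#55312203; 58#324354; Done);
(* 61 *) (cells 0001101133404244 0304142255, 58#011042; 58#110042; {1 3 ?
  58#331100; 58#331044; 58#331001; 58#400113; 1#43021431; {0 5 ? 58#331005;
  58#401105; 1#02143543; Done | 1#55021430; 58#500144; 58#500113; 1#22140553;
  1#22035431; 58#001321; Done} | 59#10012233445566; 59#00112233445566; {3 1 ?
  58#310044; 58#310042; 58#400133; 1#22340613; 1#22340316; 1#43023416;
  58#233100; 58#332640; 1#02203413; Done | {2 5 ? 60#100122334455;
  60#001122334455; {2 1 ? 58#210044; 58#400125; 1#45022413; 1#55031422;
  1#55031224; 1#55022416; 58#210043; 58#334256; 58#334254; 1#02132436; Done |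
  1#31220315; 1#55031221; 58#510044; 1#22045513; 1#22031554; 58#442533;
  58#442335; 1#02134554; Done} | 1#55220413; 1#55220316; 1#55220314; 58#335442;
  58#544001; 1#25513206; 1#25513203; 1#31552204; 58#233456; Done}}});
(* 62 *) (cells 0001021011334044 0304051314223141424555, 1#22450413;
  1#22450314; 1#31450314; 58#244001; 58#233440; 58#344002; 58#332440;
  1#55422031; 1#55412032; 58#001152; Done);
(* 63 *) (cells 000102051011334044 030422233141424555, 1#31422304; 1#55422304;
  58#344005; 58#344002; 58#544001; 1#51354223; 58#335440; 58#533440;
  1#22305541; 1#22305145; 58#001125; Done);
(* 64 *) (cells 000102111215202333404453 314245, 58#200211; 58#200115;
  58#332044; 58#532044; 58#532002; 1#21345245; Done);
(* 65 *) (cells 0001021011334044 0304131422424555, {1 2 ? 58#400211; {3 1 ?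
  58#310044; 58#310012; 58#400133; 1#03143245; 1#22340345; 1#22340341;
  58#001125; Done | 62#100122334455; 62#001122334455; 63#001155334422;
  63#001122334455; 64#001231234455; 64#001155334422; 1#22455031; 1#22413055;
  58#001125; Done} | 1#55421403; 1#55421304; 58#335440; 58#544002; 58#544001;
  1#45521403; 58#334002; 58#334001; 1#03123155; 1#22455130; 1#31521304;
  58#204334; 58#201105; 58#334005; 1#03123524; Done});
(* 66 *) (cells 00011011334044 0304142255, 61#001155334422; 61#001122334455; {1
  3 ? 58#331100; 58#331044; 58#331001; 58#400113; 1#22430430; 1#55430431;
  58#200113; 58#510044; 1#03224554; Done | 65#001155334422; 65#100155334422;
  65#001122334455; 1#22450413; 1#22450314; 1#55420413; 1#55420314; 58#235440;
  58#532440; 1#02205513; Done});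
(* 67 *) (cells 00011011334044 032255, 58#011044; 58#110044; 66#001122334455;
  Done);
(* 68 *) (cells 00011011303344 0203132225404155, {0 4 ? 58#440033; 1#55220341;
  1#55220340; 58#105104; 58#501104; 1#02255413; Done | 66#001122443355; Done});
(* 69 *) (cells 00011011303344 0313222540415566, 68#100122334455;
  68#001122334455; 58#300211; 58#300112; 1#55223140; 58#500112; 1#25523140;
  58#200211; 66^#102155330266; Done);
(* 70 *) (cells 00011011303344 03222540415566, 58#110033; 69#00112233445566;
  Done);
(* 71 *) (cells 0001041011323334354244 031322253031405055, 58#044235;
  58#100435; 58#100432; 1#22155031; 1#22130550; 1#40552213; 58#043342;
  58#102104; 58#201104; 58#200433; 1#55021423; 1#55021324; 58#324354; Done);
(* 72 *) (cells 323442 02030413142225405055, 1#40552203; 1#55220413;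
  1#55220314; 58#324354; Done);
(* 73 *) (cells 0001101132334244 03222530314041505566, {1 3 ? 58#001332;
  58#133244; 1#40552203; 58#001344; 1#30552204; 58#133442; 1#55221403;
  58#533442; 58#533244; 1#25521403; 1#22045031; 58#001321; Done | {3 4 ? {3 5 ?
  71#100122334455; 71#001122334455; 72#100122334455; 72#001122334455;
  58#001235; 1#40550413; 69^#33445220110566; Done | 1#50413522; 58#524433;
  1#03503522; 1#13503522; 1#25314053; 58#001234; 58#233244; 58#233201;
  1#03503124; Done} | 1#25504134; 58#244233; 1#03255034; 1#13255034; 58#001442;
  58#240110; 58#240011; 1#55204134; 1#50312203; 58#324453; Done}});
(* 74 *) (cells 000110113344 03222530314041505566, 1#31405522; 1#41305522;
  73#00112233445566; Done);
(* 75 *) (cells 0001101133445051 0304142225303140415566, {0 2 ? 58#105102;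
  58#501102; 1#25521403; 1#55221403; 58#235100; 58#335002; 1#20413255; Done |
  {0 6 ? 58#105106; 58#501106; 1#02255614; Done | {1 3 ? 58#500113; 1#14035522;
  1#66035522; 58#500112; 58#621100; 58#621001; 1#14035225; 1#30416602;
  1#40660225; 1#40316603; 58#123345; Done | 1#55220413; 1#55220314;
  73^#00115533442266; Done}}});
(* 76 *) (cells 000110113344 03222540415566, 70#01102233445566;
  70#00112233445566; 74#01102233445566; 74#00112233445566; {1 4 ? 58#005114;
  58#500114; 66#005122331466; Done | 75#10012244335566; 75#00112233445566;
  58#331004; 58#440013; 58#500113; 1#25534034; 1#25534031; 58#001124; Done});
(* 77 *) (cells 000110113344 032240415566, 76#00112233446655;
  76#00115533442266; 76#00115533446622; 76#00116633442255; 76#00116633445522;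
  76#00112233445566; 58#256256; Done);
(* 78 *) (cells 000110113344 032240415566, 77#00112233445566; Done);
(* 79 *) (cells 000106101166677677 225560, 58#660011; 58#760110;
  66#667722110055; Done);
(* 80 *) (cells 000110111666677677 225560, 58#661001; 58#761100;
  66#667722011055; Done);
(* 81 *) (cells 1133364466677677 0306071617404160, 58#677633; 58#776633;
  1#40630716; 1#40630617; 58#366744; 58#476633; 58#667744; 58#766744;
  1#16034064; 1#34736041; 58#113644; Done);
(* 82 *) (cells 00011011334466677677 032240415560, 79#0011223344556776;
  79#0011223344556677; 80#0011223344556776; 80#0011223344556677;
  81#0011223344556776; 77#00112266443755; Done);
(* 83 *) (cells 000110113344 032255, 67#011022334455; 67#001122334455;
  78#00112233445567; 78#00112233445576; 78#00112233445577; 78#00112233445566;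
  82#0110223344557667; 82#0011223344556677; 58#006671; Done);
(* 84 *) (cells 000110113344 0322, 83#001122334457; 83#001122334465;
  83#001122334466; 83#001122334476; 83#001122334477; 83#001122334455;
  58#556677; Done);
(* 85 *) (cells 000110113344 22, 84^#1001223344; 84#0011223344; 58#001133;
  Done);
(* 86 *) (cells 0001101133 22, 85#0011223347; 85#0011223354; 85#0011223355;
  85#0011223365; 85#0011223366; 85#0011223376; 85#0011223377; 85#0011223344;
  1#44556677; Done);
(* 87 *) (cells 00011011 22, 86#00112236; 86#00112243; 86#00112244;
  86#00112254; 86#00112255; 86#00112265; 86#00112266; 86#00112233; 1#33445566;
  Done);
(* 88 *) (cells 00011011 Decimal.Nil, 87#001124; 87#001132; 87#001133;
  87#001143; 87#001144; 87#001122; 58#223344; Done)].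

(** From 90 on the patterns are entirely blue and lose one edge at a time. From 91 on, the edges
    that would extend a pattern to the previous one are red, and four of them form a red [C4]. *)
Definition red_C4_cert : seq (seq cell * cert) := [::
(* 89 *) (cells 3353 00020511121421233046, {0 3 ? {0 1 ? 88#3301; 88#5301;
  1#51300214; 88#0354; 88#3354; 1#21143002; 1#21120430; 1#51143002; 1#51120430;
  88#2052; Done | {0 4 ? 88#3304; 88#5304; 1#21143005; 1#21003412; 1#54300211;
  1#54300112; 88#3351; 88#5225; 1#00311455; Done | {0 6 ? 88#3306; 88#5306;
  1#46300211; 1#46300112; 1#56300211; 1#56300112; 88#4152; Done | 1#46021123;
  {1 3 ? {1 0 ? 88#4310; 88#5310; 1#30460211; 1#30460112; 1#50460211;
  1#50460112; 88#3152; Done | {2 0 ? {2 2 ? {3 1 ? 88#4331; 88#5331;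
  1#51460210; 1#51460012; 88#2052; Done | 1#46021130; 1#46003112; 88#2042;
  Done} | 1#30041221; 1#30041122; 1#46001221; 1#46001122; 88#3142; Done} |
  1#30210412; 1#46002112; 88#3243; Done}} | 1#30021321; 1#30012312; 1#46021321;
  1#46012312; 88#3142; Done}}}} | 1#30032114; 1#30032112; 88#5334; 88#5332;
  1#02541123; Done});
(* 90 *) (cells Decimal.Nil 00020511121421233046, 1#30021123;
  89#00112233446556; 89#00112233445566; 1#53211205; 1#53211200; 1#63211205;
  1#63211200; 88#5065; Done);
(* 91 *) (cells Decimal.Nil 000205111421233046, 90#00112533445266;
  90#00211234435566; 90#00211534435266; 90#00112233445566; 88#1225; Done);
(* 92 *) (cells Decimal.Nil 0002051114233046, 91#00142233415566;
  91#00114236245563; 91#00144236215563; 91#00112233445566; 88#2144; Done);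
(* 93 *) (cells Decimal.Nil 00020511142330, 92#00112233445567;
  92#00112233544566; 92#00112233544567; 92#00112233445566; 88#4657; Done);
(* 94 *) (cells Decimal.Nil 000205111423, 93#021120334455; 93#001122433455;
  93#021120433455; 93#001122334455; 88#3042; Done);
(* 95 *) (cells Decimal.Nil 0002111423, 94#001122334456; 94#110024334255;
  94#110024334256; 94#001122334455; 88#0516; Done);
(* 96 *) (cells Decimal.Nil 00021123, 95#0011223345; 95#0023123144;
  95#0023123145; 95#0011223344; 88#1425; Done);
(* 97 *) (cells Decimal.Nil 000211, 96#00112234; 96#00113223; 96#00113224;
  96#00112233; 88#2334; Done);
(* 98 *) (cells Decimal.Nil 0011, 97#001123; 97#110022; 97#110023; 97#001122;
  88#0213; Done);
(* 99 *) (cells Decimal.Nil 00, 98#0012; 98#0021; 98#0022; 98#0011; 88#1122;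
  Done);
(* 100 *) (cells Decimal.Nil Decimal.Nil, 99#01; 99#10; 99#11; 99#00; 88#0011;
  Done)].

(** This order of the lists makes positions agree with pattern numbers. *)
Lemma certificate_checks :
  check_all excluded_cycles
    (no_red_C8_cert ++ no_red_C6_cert ++ no_red_C4_cert ++ red_C4_cert).
Proof. by vm_compute. Qed.

(** * Colourings of the complete bipartite graph *)

(** Reindexings keep indices below 8, where [inord] is faithful. *)
Definition matrix_of (c : edge_coloring (complete_bipartite 8 8)) (i j : nat) :=
  c [set inl (inord i); inr (inord j)].

(** Vertices 2i and 2i+1 of the cycle go to the images of row i and column i. The diagonal cells
    colour the edges from 2i to 2i+1, the others those from 2i+1 to 2i+2. *)
Lemma mono_cycle_of_pattern (c : edge_coloring (complete_bipartite 8 8))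
    b k t f h :
  k <= 8 -> reindexing f -> reindexing h ->
  all (agrees (matrix_of c)) (map (place t f h) (cycle_pattern b k)) ->
  has_mono_copy (cycle_graph k.*2) c b.
Proof.
move=> k8 [f8 fI] [h8 hI]; rewrite all_agrees_place all_cat !all_map.
case/andP=> /allP diag /allP offdiag.
pose u i : complete_bipartite 8 8 :=
  if t then inr (inord (f i)) else inl (inord (f i)).
pose w i : complete_bipartite 8 8 :=
  if t then inl (inord (h i)) else inr (inord (h i)).
have uw i j : adj (u i) (w j) by rewrite /u /w; case: (t).
have ucol i j : c [set u i; w j] = pullback (matrix_of c) t f h i j.
  by rewrite /u /w /pullback /matrix_of; case: (t); rewrite // setUC.
have cdiag i : i < k -> c [set u i; w i] = b.
  by move=> ik; rewrite ucol; apply/eqP/diag; rewrite mem_iota.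
have coff i : i < k -> c [set u (i.+1 %% k); w i] = b.
  by move=> ik; rewrite ucol; apply/eqP/offdiag; rewrite mem_iota.
have injord (i j : nat) : i < 8 -> j < 8 -> inord i = inord j :> 'I_8 -> i = j.
  by move=> i8 j8 /(congr1 val); rewrite /= !inordK.
have uI i j : i < 8 -> j < 8 -> u i = u j -> i = j.
  rewrite /u => i8 j8.
  by case: (t) => -[] /injord; rewrite !f8 // => /(_ isT isT); apply: fI.
have wI i j : i < 8 -> j < 8 -> w i = w j -> i = j.
  rewrite /w => i8 j8.
  by case: (t) => -[] /injord; rewrite !h8 // => /(_ isT isT); apply: hI.
have uNw i j : u i <> w j by rewrite /u /w; case: (t).
pose F (x : nat) := if odd x then w x./2 else u x./2.
have halfk (x : 'I_k.*2) : x./2 < k by rewrite ltn_half_double.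
have half8 (x : 'I_k.*2) : x./2 < 8 by apply: leq_trans (halfk x) k8.
have step (x y : 'I_k.*2) : x.+1 == y %[mod k.*2] ->
    adj (F x) (F y) /\ c [set F x; F y] = b.
  rewrite (modn_small (ltn_ord y)) /F => /eqP <-.
  move: (odd x) (x./2) (odd_double_half x) (halfk x) => o m <-.
  case: o => /= mk.
    (* From an odd vertex 2m+1 the successor is 2(m+1) mod 2k, that is 2((m+1) mod k); the cycle can
       only wrap around here. *)
    rewrite add1n -doubleS -!muln2 -muln_modl muln2 odd_double doubleK.
    by rewrite setUC bipartite_adj_sym; split; [apply: uw | apply: coff].
  rewrite add0n modn_small ?ltn_Sdouble //= odd_double uphalf_double.
  by split; [apply: uw | apply: cdiag].
exists (fun x : 'I_k.*2 => F x); split.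
  move=> x y; rewrite /F => eqF; apply: val_inj => /=.
  rewrite -(odd_double_half x) -(odd_double_half y).
  move: eqF; case: (odd x) (odd y) => -[] //.
  - by move/wI => -> //; apply: half8.
  - by move=> e; case: (uNw y./2 x./2).
  - by move=> /uNw.
  by move/uI => -> //; apply: half8.
move=> x y /andP[_ /orP[/step // | /step]].
by rewrite adj_sym setUC.
Qed.

(** A copy can be sought among finitely many functions, so [arrows_8] may argue by cases on its
    existence constructively. *)
Lemma has_mono_copyP (G H : sgraph) (c : edge_coloring H) k :
  reflect (has_mono_copy G c k)
    [exists f : {ffun G -> H}, injectiveb f &&
      [forall x, forall y,
         adj x y ==> adj (f x) (f y) && (c [set f x; f y] == k)]].
Proof.
apply: (iffP existsP) => [[f /andP[/injectiveP fI /forallP fA]]|[f [fI fA]]].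
  exists f; split=> // x y xy.
  by have /forallP/(_ y) := fA x; rewrite xy => /andP[-> /eqP].
exists (finfun f); apply/andP; split.
  by apply/injectiveP => x y; rewrite !ffunE => /fI.
apply/forallP => x; apply/forallP => y; apply/implyP => /fA[].
by rewrite !ffunE => -> ->; rewrite eqxx.
Qed.

Lemma arrows_8 : bipartite_arrows 8 (cycle_graph 10) (cycle_graph 8).
Proof.
move=> c; case: (has_mono_copyP (cycle_graph 10) c true) => [|no10].
  by left.
case: (has_mono_copyP (cycle_graph 8) c false) => [|no8].
  by right.
case: (check_all_sound (g := matrix_of c) certificate_checks) => P.
rewrite !inE => /orP[] /eqP -> t f h rf rh; apply/negP.
  by move/(@mono_cycle_of_pattern c true 5 t f h isT rf rh)/no10.
by move/(@mono_cycle_of_pattern c false 4 t f h isT rf rh)/no8.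
Qed.

(** * The lower bound *)

(* The edges joining the vertices [2i] and [2i+1] of the cycle are disjoint,
   and each of them has one end on the left. *)
Lemma left_ends_of_cycle b k (c : edge_coloring (complete_bipartite b b)) v :
  has_mono_copy (cycle_graph k.*2) c v ->
  exists2 e : 'I_k -> 'I_b, injective e &
    forall i, exists j, c [set inl (e i); inr j] = v.
Proof.
case=> f [fI fA].
have even_lt (i : 'I_k) : i.*2 < k.*2 by rewrite ltn_double.
have odd_lt (i : 'I_k) : i.*2.+1 < k.*2 by rewrite ltn_Sdouble.
have ends (i : 'I_k) : exists l : 'I_b,
    (exists x : 'I_k.*2, x./2 = i /\ f x = inl l) /\
    exists j, c [set inl l; inr j] = v.
  have [] := fA (Ordinal (even_lt i)) (Ordinal (odd_lt i)).
    by rewrite /= /cycle_adj /= eqxx andbT -val_eqE /= neq_ltn ltnSn.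
  case E0: (f (Ordinal (even_lt i))) => [l|j];
    case E1: (f (Ordinal (odd_lt i))) => [l'|j'] // _ cE.
    exists l; split; last by exists j'.
    by exists (Ordinal (even_lt i)); rewrite /= doubleK.
  exists l'; split; last by exists j; rewrite setUC.
  by exists (Ordinal (odd_lt i)); rewrite /= uphalf_double.
have [e eP] := fin_all_exists ends.
exists e => [i j eij|i]; last by case: (eP i).
(* Equal left ends come from one cycle vertex, by injectivity of [f], and its half is both [i] and
   [j]. *)
have [[x [xi fx]] _] := eP i; have [[y [yj fy]] _] := eP j.
by apply: val_inj; rewrite /= -xi -yj (fI x y) // fx fy eij.
Qed.

(** A colouring takes a set of vertices, so the left end has to be searched for in it. *)
Definition split_coloring b : edge_coloring (complete_bipartite b b) :=
  fun A => [exists i : 'I_b, (i < 4) && (inl i \in A)].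

Lemma split_coloringE b (i j : 'I_b) :
  split_coloring [set inl i; inr j] = (i < 4).
Proof.
apply/existsP/idP => [[l]|i4]; last by exists i; rewrite i4 !inE eqxx.
by rewrite !inE orbF => /andP[l4 /eqP[<-]].
Qed.

(** Pigeonhole, with values in [nat] so that it also applies to shifted indices. *)
Lemma no_injection_to_lt k m (f : 'I_k -> nat) :
  m < k -> injective f -> ~ (forall i, f i < m).
Proof.
move=> mk fI fm; have oI : injective (fun i => Ordinal (fm i)).
  by move=> i j [/fI].
by have := leq_card _ oI; rewrite !card_ord leqNgt mk.
Qed.

Theorem theorem6 : is_BR (cycle_graph 10) (cycle_graph 8) 8.
Proof.
split=> [//||b _ arr]; first exact: arrows_8.
rewrite leqNgt; apply/negP => b8.
case: (arr (@split_coloring b)).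
  (* A red [C10] would have five left vertices with index below 4. *)
  case/(@left_ends_of_cycle b 5) => e eI eE.
  apply: (@no_injection_to_lt 5 4 (fun i => e i)) => // [i j /val_inj /eI //|i].
  by have [j] := eE i; rewrite split_coloringE.
case/(@left_ends_of_cycle b 4) => e eI eE.
have e4 i : 4 <= e i.
  by have [j] := eE i; rewrite split_coloringE => /negbT; rewrite -leqNgt.
(* The four left vertices of a blue [C8] have indices from 4 to at most 6, since [b < 8]; shifting
   by 4 puts them below 3. *)
apply: (@no_injection_to_lt 4 3 (fun i => e i - 4)) => // [i j /eqP|i].
  by rewrite eqn_sub2rE // => /eqP/val_inj/eI.
by rewrite ltn_subLR //; apply: leq_trans (ltn_ord (e i)) b8.
Qed.
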